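(* Let $\ell\ge2$, $\ell_1=\lfloor\ell/2\rfloor$. Let $A_1=\begin{pmatrix}0&\epsilon\alpha_1\\ \epsilon&0\end{pmatrix}$ and $A_2=\begin{pmatrix}0&\epsilon\alpha_2\\ \epsilon&0\end{pmatrix}$ in $\mathfrak g(\mathfrak o_{\ell_1})$ with $\mathrm{tt}(A_1)=\mathbf{cus}$ and $\mathrm{tt}(A_2)\in\{\mathbf{ss},\mathbf{sns}\}$, and fix Serre lifts $\tilde A_i=\begin{pmatrix}0&\epsilon\tilde\alpha_i\\ \epsilon&0\end{pmatrix}\in\mathfrak g(\mathfrak o_\ell)$. For $g\in\mathrm G(\mathfrak o_\ell)$ let $W_g$ be the set of double cosets $S_{A_1}hS_{A_2}$, $h\in\mathrm G(\mathfrak o_\ell)$, such that $\tilde A_1+g\tilde A_2g^{-1}$ and $\tilde A_1+h\tilde A_2h^{-1}$ are $\mathrm G(\mathfrak o_\ell)$-conjugate modulo $\pi^{\ell_1}$. Then $|W_g|=1$ for every $g\in\mathrm G(\mathfrak o_\ell)$.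
   Context: Let $\mathcal O$ be a complete discrete valuation ring with maximal ideal $\mathfrak p=\pi\mathcal O$ and finite residue field of odd characteristic and cardinality $q$. Let $\mathfrak O=\mathcal O[\vartheta]$ be the unramified quadratic extension, with $\vartheta^2\in\mathcal O^\times$ a non-square, and Galois involution $x\mapsto x^\circ$, $\vartheta^\circ=-\vartheta$. Let $\mathfrak o_k=\mathcal O/\mathfrak p^k$ and $\mathfrak O_k=\mathfrak O/\pi^k\mathfrak O$. $\mathrm G$ denotes either $\mathrm{GL}_2$ (so $\mathrm G(\mathfrak o_k)=\mathrm{GL}_2(\mathfrak o_k)$, $R_k=\mathfrak o_k$, $\epsilon=1$, $\mathfrak g(\mathfrak o_k)=M_2(\mathfrak o_k)$) or $\mathrm{GU}_2$ (so $\mathrm G(\mathfrak o_k)=\{A\in \mathrm{GL}_2(\mathfrak O_k): A^\star A=I\}$ where $(a_{ij})^\star=W(a_{ji}^\circ)W^{-1}$, $W=\begin{pmatrix}0&1\\1&0\end{pmatrix}$, $R_k=\mathfrak O_k$, $\epsilon=\vartheta$, $\mathfrak g(\mathfrak o_k)=\{A\in M_2(\mathfrak O_k):A+A^\star=0\}$). Let $\ell_2=\lceil\ell/2\rceil$, $K^{i}=\{I+\pi^iB\}\cap\mathrm G(\mathfrak o_\ell)$, and fix an additive character $\psi$ of $R_\ell$ nontrivial on $\pi^{\ell-1}\mathfrak o_\ell$. For $A\in\mathfrak g(\mathfrak o_{\ell_1})$, $\psi_A(I+\pi^{\ell_2}B)=\psi(\pi^{\ell_2}\mathrm{tr}(\tilde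 AB))$ ($\tilde A$ any lift) is a character of $K^{\ell_2}$ and $S_A$ is its stabilizer in $\mathrm G(\mathfrak o_\ell)$ under conjugation. A Serre lift keeps entries equal to $\epsilon$ or $0$ unchanged. Matrix types (up to $\mathrm G(\mathfrak o_{\ell_1})$-conjugacy): $\mathrm{tt}(A)=\mathbf{sns}$ if $A\sim\begin{pmatrix}x&\epsilon\pi\beta\\ \epsilon&x\end{pmatrix}$; $\mathbf{ss}$ if $A\sim\begin{pmatrix}x&\epsilon\delta\\ \epsilon&x\end{pmatrix}$ with $\delta$ a square unit (for $\mathrm{GL}_2$) resp. non-square unit (for $\mathrm{GU}_2$); $\mathbf{cus}$ if $A\sim\begin{pmatrix}x&\epsilon\sigma\\ \epsilon&x\end{pmatrix}$ with $\sigma$ a non-square unit (for $\mathrm{GL}_2$) resp. square unit (for $\mathrm{GU}_2$). *)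

(* Defs.v *)
From HB Require Import structures.
From mathcomp Require Import all_boot all_order all_algebra.
From mathcomp Require Import algC.
From mathcomp Require Import ring.
Set Implicit Arguments. Unset Strict Implicit. Unset Printing Implicit Defensive.
Import Order.TTheory GRing.Theory Num.Theory.
Local Open Scope ring_scope.

Definition congr_el (R : comNzRingType) (p : R) (k : nat) (x y : R) : Prop :=
  exists z : R, x - y = p ^+ k * z.

Definition congr_mx (R : comNzRingType) (p : R) (k : nat) (X Y : 'M[R]_2) : Prop :=
  exists Z : 'M[R]_2, X - Y = p ^+ k *: Z.

Definition is_cdvr_odd (O : idomainType) (pi : O) : Prop :=
  [/\ pi != 0, pi \notin GRing.unit &
      (forall x : O, x != 0 -> exists (u : O) (n : nat),
          u \is a GRing.unit /\ x = u * pi ^+ n)] /\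
  [/\
      (forall a : nat -> O, (forall n, congr_el pi n (a n.+1) (a n)) ->
          exists L : O, forall n, congr_el pi n L (a n)),
      (exists s : seq O, forall x : O, exists2 y, y \in s & congr_el pi 1 x y)
    &
      (2%:R : O) \is a GRing.unit ].

(* The quadratic extension O[theta] with theta^2 = d, as pairs a + b theta *)

Record quad (O : comNzRingType) (d : O) := Quad { qa : O; qb : O }.
Arguments Quad {O d}.
Arguments qa {O d}.
Arguments qb {O d}.

Section Quad.
Variables (O : comNzRingType) (d : O).
Local Notation quad := (quad d).

Definition q2p (x : quad) := (qa x, qb x).
Definition p2q (x : O * O) : quad := Quad x.1 x.2.
Lemma q2pK : cancel q2p p2q. Proof. by case. Qed.
HB.instance Definition _ := Choice.copy quad (can_type q2pK).

Definition qzero : quad := Quad 0 0.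
Definition qopp (x : quad) : quad := Quad (- qa x) (- qb x).
Definition qadd (x y : quad) : quad := Quad (qa x + qa y) (qb x + qb y).
Definition qone : quad := Quad 1 0.
Definition qmul (x y : quad) : quad := Quad (qa x * qa y + d * (qb x * qb y)) (qa x * qb y + qb x * qa y).

Lemma qaddA : associative qadd.
Proof. by move=> [? ?] [? ?] [? ?]; rewrite /qadd /= !addrA. Qed.
Lemma qaddC : commutative qadd.
Proof. by move=> [a b] [c e]; rewrite /qadd /= (addrC a) (addrC b). Qed.
Lemma qadd0 : left_id qzero qadd.
Proof. by move=> [? ?]; rewrite /qadd /= !add0r. Qed.
Lemma qaddN : left_inverse qzero qopp qadd.
Proof. by move=> [? ?]; rewrite /qadd /= !addNr. Qed.

HB.instance Definition _ := GRing.isZmodule.Build quad qaddA qaddC qadd0 qaddN.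

Lemma qmulA : associative qmul.
Proof. move=> [a b] [c e] [f g]; rewrite /qmul /=; congr Quad; ring. Qed.
Lemma qmulC : commutative qmul.
Proof. move=> [a b] [c e]; rewrite /qmul /=; congr Quad; ring. Qed.
Lemma qmul1 : left_id qone qmul.
Proof. move=> [a b]; rewrite /qmul /=; congr Quad; ring. Qed.
Lemma qmulDl : left_distributive qmul qadd.
Proof. move=> [a b] [c e] [f g]; rewrite /qmul /qadd /=; congr Quad; ring. Qed.
Lemma qone_neq0 : qone != (0 : quad).
Proof. by apply/eqP => -[] /eqP; rewrite oner_eq0. Qed.

HB.instance Definition _ :=
  GRing.Zmodule_isComNzRing.Build quad qmulA qmulC qmul1 qmulDl qone_neq0.

Definition qemb (a : O) : quad := Quad a 0.
Definition qtheta : quad := Quad 0 1.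
Definition qconj (x : quad) : quad := Quad (qa x) (- qb x).

End Quad.

(* Generic setting: elements of G(o_k), g(o_k) are represented by lifts *)
(* (2x2 matrices over the ring R = O or O[theta]); equalities in o_k are *)
(* congruences modulo p^k.                                               *)

Definition mx2 (R : comNzRingType) (a b c e : R) : 'M[R]_2 :=
  \matrix_(i < 2, j < 2)
    if nat_of_ord i == 0%N then (if nat_of_ord j == 0%N then a else b)
    else (if nat_of_ord j == 0%N then c else e).

Section Generic.
Variables (O : idomainType) (pi : O) (R : comNzRingType) (emb : O -> R)
  (eps : R)
  (Gm : nat -> 'M[R]_2 -> Prop)   (* Gm k X : X represents an element of G(o_k) *)
  (gm : nat -> 'M[R]_2 -> Prop)   (* gm k X : X represents an element of g(o_k) *)
  (ss_square : bool).              (* ss uses square units (GL2) / non-squares (GU2) *)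

Local Notation p := (emb pi).
Local Notation cmx := (congr_mx p).

Definition inv_mod (k : nat) (g gi : 'M[R]_2) := cmx k (g *m gi) 1.

Definition conj_mod (kG k : nat) (X Y : 'M[R]_2) :=
  exists c, Gm kG c /\ cmx k (c *m X) (Y *m c).

Definition unit_mod (k : nat) (x : O) := exists u : O, congr_el pi k (x * u) 1.
Definition square_mod (k : nat) (x : O) := exists y : O, congr_el pi k (y * y) x.

Definition tt_sns (k : nat) (A : 'M[R]_2) :=
  exists x beta : R, conj_mod k k A (mx2 x (eps * p * beta) eps x).
Definition tt_ss (k : nat) (A : 'M[R]_2) :=
  exists (x : R) (delta : O), unit_mod k delta /\
    (if ss_square then square_mod k delta else ~ square_mod k delta) /\
    conj_mod k k A (mx2 x (eps * emb delta) eps x).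
Definition tt_cus (k : nat) (A : 'M[R]_2) :=
  exists (x : R) (sigma : O), unit_mod k sigma /\
    (if ss_square then ~ square_mod k sigma else square_mod k sigma) /\
    conj_mod k k A (mx2 x (eps * emb sigma) eps x).

(* psi : additive character of R_l = R / p^l R, nontrivial on p^(l-1) o_l *)
Definition is_psi (l : nat) (psi : R -> algC) :=
  [/\ psi 0 = 1, (forall x y, psi (x + y) = psi x * psi y),
      (forall x, psi (p ^+ l * x) = 1)
    & exists x : O, psi (p ^+ l.-1 * emb x) != 1].

(* psi_A (I + p^l2 B) = psi (p^l2 tr (A~ B)), l2 = ceil(l/2) *)
Definition psiA (psi : R -> algC) (l : nat) (At B : 'M[R]_2) :=
  psi (p ^+ uphalf l * \tr (At *m B)).

(* S_A : stabilizer in G(o_l) of psi_A under conjugation *)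
Definition stab (psi : R -> algC) (l : nat) (At s : 'M[R]_2) :=
  Gm l s /\ exists si, inv_mod l s si /\
    forall B B' : 'M[R]_2, Gm l (1 + p ^+ uphalf l *: B) ->
      cmx l (s *m (1 + p ^+ uphalf l *: B) *m si) (1 + p ^+ uphalf l *: B') ->
      psiA psi l At B' = psiA psi l At B.

Definition dcoset (psi : R -> algC) (l : nat) (A1 A2 h x : 'M[R]_2) :=
  Gm l x /\ exists s1 s2, stab psi l A1 s1 /\ stab psi l A2 s2 /\
    cmx l x (s1 *m h *m s2).

(* the double coset of h belongs to W_g *)
Definition Wcond (l : nat) (At1 At2 g h : 'M[R]_2) :=
  Gm l h /\ exists gi hi, inv_mod l g gi /\ inv_mod l h hi /\
    conj_mod l l./2 (At1 + g *m At2 *m gi) (At1 + h *m At2 *m hi).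

Definition W_card1 (psi : R -> algC) (l : nat) (A1 A2 At1 At2 g : 'M[R]_2) :=
  exists h0, Wcond l At1 At2 g h0 /\
    forall h, Wcond l At1 At2 g h ->
      forall x, dcoset psi l A1 A2 h x <-> dcoset psi l A1 A2 h0 x.

Definition thm6p10_generic : Prop :=
  forall (l : nat) (psi : R -> algC) (a1 a2 at1 at2 : R),
    (2 <= l)%N -> is_psi l psi ->
    let A1 := mx2 0 (eps * a1) eps 0 in
    let A2 := mx2 0 (eps * a2) eps 0 in
    let At1 := mx2 0 (eps * at1) eps 0 in
    let At2 := mx2 0 (eps * at2) eps 0 in
    gm l./2 A1 -> gm l./2 A2 ->
    gm l At1 -> gm l At2 ->
    congr_el p l./2 at1 a1 -> congr_el p l./2 at2 a2 ->
    tt_cus l./2 A1 -> tt_ss l./2 A2 \/ tt_sns l./2 A2 ->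
    forall g, Gm l g -> W_card1 psi l A1 A2 At1 At2 g.

End Generic.

Definition GL_G (O : idomainType) (pi : O) (k : nat) (X : 'M[O]_2) :=
  exists Y : 'M[O]_2, congr_mx pi k (X *m Y) 1.
Definition GL_g (O : idomainType) (k : nat) (X : 'M[O]_2) := True.

Definition thm6p10_GL (O : idomainType) (pi : O) : Prop :=
  @thm6p10_generic O pi O id 1 (GL_G pi) (@GL_g O) true.

Definition Wmx (R : comNzRingType) : 'M[R]_2 := mx2 0 1 1 0.
(* (a_ij)^* = W (a_ji^o) W^-1 *)
Definition ustar (O : comNzRingType) (d : O) (X : 'M[quad d]_2) : 'M[quad d]_2 :=
  Wmx _ *m (map_mx (@qconj O d) X)^T *m Wmx _.

Definition GU_G (O : idomainType) (pi d : O) (k : nat) (X : 'M[quad d]_2) :=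
  congr_mx (qemb d pi) k (ustar X *m X) 1.
Definition GU_g (O : idomainType) (pi d : O) (k : nat) (X : 'M[quad d]_2) :=
  congr_mx (qemb d pi) k (X + ustar X) 0.

Definition thm6p10_GU (O : idomainType) (pi d : O) : Prop :=
  @thm6p10_generic O pi (quad d) (@qemb O d) (qtheta d)
    (GU_G pi (d:=d)) (GU_g pi (d:=d)) false.

(* Main.v *)
Require Import Defs.
From HB Require Import structures.
From mathcomp Require Import all_boot all_order all_algebra.
From mathcomp Require Import ring.
From Stdlib Require Import Setoid Morphisms.
Set Implicit Arguments. Unset Strict Implicit. Unset Printing Implicit Defensive.
Import GRing.Theory.
Local Open Scope ring_scope.

(** Put [k = l./2]. Elements of [G] commuting with [A_i] modulo [pi^k] lie in
    [S_{A_i}], so if [h = s1 g s2] with such [s1], [s2], then [g] and [h] define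
    the same double coset; for this it suffices to find [s1] commuting with
    [A_1] and conjugating [B = g A_2 g^-1] to [B' = h A_2 h^-1] modulo [pi^k].
    Now [B] and [B'] have trace 0 and equal determinants, and conjugacy of
    [A_1 + B] and [A_1 + B'] adds [tr (A_1 B) = tr (A_1 B')]. These equations
    make [s B = B' s] explicitly solvable with [s = x + y A_1]. Since [A_1] is
    cuspidal, [-det A_1] is not a square modulo [pi], so [s] is invertible
    unless [x] and [y] both vanish modulo [pi]; if this happens for both of the
    available solutions, then [B] is a multiple of [A_1] modulo [pi], which the
    type of [A_2] forbids. In the unitary case trace-zero elements of [g] have
    coordinates in [O], and [s] becomes unitary after division by an element
    of [O[theta]] of norm [det s]. *)

(** * Congruences between ring elements *)

Section CongrEl.
Variables (R : comNzRingType) (p : R).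
Implicit Types (k : nat) (x y z : R).

(** Reduces a congruence to one ring identity: once the coefficients of the known congruences are
    given, [ring] checks the rest. The two variants below serve the same purpose. *)
Lemma congr_el_comb1 k x1 y1 c1 x y : congr_el p k x1 y1 ->
  x - y = c1 * (x1 - y1) -> congr_el p k x y.
Proof. by move=> [z1 e1] e; exists (c1 * z1); rewrite e e1; ring. Qed.

Lemma congr_el_comb2 k x1 y1 x2 y2 c1 c2 x y :
  congr_el p k x1 y1 -> congr_el p k x2 y2 ->
  x - y = c1 * (x1 - y1) + c2 * (x2 - y2) -> congr_el p k x y.
Proof. by move=> [z1 e1] [z2 e2] e; exists (c1 * z1 + c2 * z2); rewrite e e1 e2; ring. Qed.

Lemma congr_el_comb3 k x1 y1 x2 y2 x3 y3 c1 c2 c3 x y :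
  congr_el p k x1 y1 -> congr_el p k x2 y2 -> congr_el p k x3 y3 ->
  x - y = c1 * (x1 - y1) + c2 * (x2 - y2) + c3 * (x3 - y3) ->
  congr_el p k x y.
Proof.
move=> [z1 e1] [z2 e2] [z3 e3] e.
by exists (c1 * z1 + c2 * z2 + c3 * z3); rewrite e e1 e2 e3; ring.
Qed.

Lemma congr_el_refl k x : congr_el p k x x.
Proof. by exists 0; ring. Qed.

Lemma congr_el_sym k x y : congr_el p k x y -> congr_el p k y x.
Proof. by move=> h; apply: (congr_el_comb1 (c1 := -1) h); ring. Qed.

Lemma congr_el_trans k x y z :
  congr_el p k x y -> congr_el p k y z -> congr_el p k x z.
Proof. by move=> h1 h2; apply: (congr_el_comb2 (c1 := 1) (c2 := 1) h1 h2); ring. Qed.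

Lemma congr_el_leq k m x y : (m <= k)%N -> congr_el p k x y -> congr_el p m x y.
Proof.
move=> le_mk [z e]; exists (p ^+ (k - m) * z).
by rewrite e mulrA -exprD subnKC.
Qed.

End CongrEl.

(** * Congruences between 2 by 2 matrices, set up for rewriting *)

Section CongrMx.
Variables (R : comNzRingType) (p : R).
Implicit Types (k : nat) (X Y Z : 'M[R]_2).

Lemma congr_mx_refl k X : congr_mx p k X X.
Proof. by exists 0; rewrite subrr scaler0. Qed.

Lemma congr_mx_sym k X Y : congr_mx p k X Y -> congr_mx p k Y X.
Proof. by move=> [Z hZ]; exists (- Z); rewrite scalerN -hZ opprB. Qed.

Lemma congr_mx_trans k X Y Z :
  congr_mx p k X Y -> congr_mx p k Y Z -> congr_mx p k X Z.
Proof.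
move=> [U hU] [V hV]; exists (U + V).
by rewrite scalerDr -hU -hV addrA subrK.
Qed.

#[global] Instance congr_mx_equiv k : Equivalence (congr_mx p k).
Proof.
by split; [exact: congr_mx_refl|exact: congr_mx_sym|exact: congr_mx_trans].
Qed.

#[global] Instance congr_mx_mulmx k :
  Proper (congr_mx p k ==> congr_mx p k ==> congr_mx p k) (@mulmx R 2 2 2).
Proof.
move=> X X' [U hU] Y Y' [V hV]; exists (U *m Y + X' *m V).
rewrite scalerDr scalemxAl [_ *: (X' *m V)]scalemxAr -hU -hV mulmxBl mulmxBr.
by rewrite addrA subrK.
Qed.

#[global] Instance congr_mx_add k :
  Proper (congr_mx p k ==> congr_mx p k ==> congr_mx p k) (@GRing.add 'M[R]_2).
Proof.
move=> X X' [U hU] Y Y' [V hV]; exists (U + V).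
by rewrite scalerDr -hU -hV opprD addrACA.
Qed.

#[global] Instance congr_mx_scale k a :
  Proper (congr_mx p k ==> congr_mx p k) ( *:%R a : 'M[R]_2 -> 'M[R]_2).
Proof.
move=> X X' [U hU]; exists (a *: U).
by rewrite -scalerBr hU !scalerA mulrC.
Qed.

Lemma congr_mx_leq k m X Y : (m <= k)%N -> congr_mx p k X Y -> congr_mx p m X Y.
Proof.
move=> le_mk [Z e]; exists (p ^+ (k - m) *: Z).
by rewrite e scalerA -exprD subnKC.
Qed.

Lemma congr_mxP k X Y :
  congr_mx p k X Y <-> (forall i j, congr_el p k (X i j) (Y i j)).
Proof.
split=> [[Z hZ] i j|h].
  by exists (Z i j); have := congr1 (fun M : 'M_2 => M i j) hZ; rewrite !mxE.
have [z00 h00] := h 0 0; have [z01 h01] := h 0 1.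
have [z10 h10] := h 1 0; have [z11 h11] := h 1 1.
exists (mx2 z00 z01 z10 z11); apply/matrixP => i j; rewrite !mxE.
case: i j => [[|[|//]] hi] [[|[|//]] hj] /=.
- by rewrite -h00; congr (X _ _ - Y _ _); apply: val_inj.
- by rewrite -h01; congr (X _ _ - Y _ _); apply: val_inj.
- by rewrite -h10; congr (X _ _ - Y _ _); apply: val_inj.
- by rewrite -h11; congr (X _ _ - Y _ _); apply: val_inj.
Qed.

Lemma mx2_eta X : X = mx2 (X 0 0) (X 0 1) (X 1 0) (X 1 1).
Proof.
apply/matrixP => i j; rewrite !mxE.
by case: i j => [[|[|//]] hi] [[|[|//]] hj] /=; congr (X _ _); apply: val_inj.
Qed.

Lemma congr_mx2 k (a b c e a' b' c' e' : R) :
  congr_mx p k (mx2 a b c e) (mx2 a' b' c' e') <->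
  [/\ congr_el p k a a', congr_el p k b b', congr_el p k c c'
    & congr_el p k e e'].
Proof.
split=> [/congr_mxP h|[ha hb hc he]].
  by move: (h 0 0) (h 0 1) (h 1 0) (h 1 1); rewrite !mxE.
by apply/congr_mxP => i j; rewrite !mxE; case: ifP; case: ifP.
Qed.

Lemma mulmx2 (a b c e a' b' c' e' : R) :
  mx2 a b c e *m mx2 a' b' c' e' =
  mx2 (a * a' + b * c') (a * b' + b * e') (c * a' + e * c') (c * b' + e * e').
Proof.
apply/matrixP => i j; rewrite !mxE big_ord_recl big_ord1 !mxE /=.
by case: ifP; case: ifP.
Qed.

Lemma addmx2 (a b c e a' b' c' e' : R) :
  mx2 a b c e + mx2 a' b' c' e' = mx2 (a + a') (b + b') (c + c') (e + e').
Proof. by apply/matrixP => i j; rewrite !mxE; case: ifP; case: ifP. Qed.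

Lemma scalemx2 (t a b c e : R) :
  t *: mx2 a b c e = mx2 (t * a) (t * b) (t * c) (t * e).
Proof. by apply/matrixP => i j; rewrite !mxE; case: ifP; case: ifP. Qed.

Lemma mx2_1 : 1 = mx2 1 0 0 1 :> 'M[R]_2.
Proof. by rewrite [LHS]mx2_eta !mxE. Qed.

Lemma mx2_0 : 0 = mx2 0 0 0 0 :> 'M[R]_2.
Proof. by rewrite [LHS]mx2_eta !mxE. Qed.

Lemma mxtrace2 (a b c e : R) : \tr (mx2 a b c e) = a + e.
Proof. by rewrite /mxtrace big_ord_recl big_ord1 !mxE. Qed.

Lemma det_mx2 (a b c e : R) : \det (mx2 a b c e) = a * e - b * c.
Proof. 
rewrite (expand_det_row _ 0) big_ord_recl big_ord1 /cofactor !det_mx11 !mxE /=.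
by rewrite expr0 expr1; ring.
Qed.

Lemma congr_mx_tr k X Y : congr_mx p k X Y -> congr_el p k (\tr X) (\tr Y).
Proof.
rewrite (mx2_eta X) (mx2_eta Y) => /congr_mx2 [h1 _ _ h4].
by rewrite !mxtrace2; apply: (congr_el_comb2 (c1 := 1) (c2 := 1) h1 h4); ring.
Qed.

Lemma congr_mx_det k X Y : congr_mx p k X Y -> congr_el p k (\det X) (\det Y).
Proof.
rewrite (mx2_eta X) (mx2_eta Y) => /congr_mx2 [h1 h2 h3 h4]; rewrite !det_mx2.
have h14 : congr_el p k (X 0 0 * X 1 1) (Y 0 0 * Y 1 1).
  by apply: (congr_el_comb2 (c1 := X 1 1) (c2 := Y 0 0) h1 h4); ring.
apply: (congr_el_comb3 (c1 := 1) (c2 := - X 1 0) (c3 := - Y 0 1) h14 h2 h3).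
by ring.
Qed.

(** Sandwiching [X *m Y] between the adjugate of [X] and [X] gives [det X * (Y X) = det X] modulo
    [p^k]; the factor [det X] is then removed by its inverse [det Y]. *)
Lemma congr_mx1C k X Y : congr_mx p k (X *m Y) 1 -> congr_mx p k (Y *m X) 1.
Proof.
move=> h; have [z hz] := congr_mx_det h; move: hz; rewrite det_mulmx det1 => hz.
have e1 : \det X *: (Y *m X) = \adj X *m (X *m Y) *m X.
  by rewrite mulmxA mul_adj_mx mul_scalar_mx scalemxAl.
have e2 : congr_mx p k (\det X *: (Y *m X)) (\det X *: 1).
  by rewrite e1 h mulmx1 mul_adj_mx scalemx1; reflexivity.
have e3 : congr_mx p k (\det Y *: (\det X *: (Y *m X))) (\det Y *: (\det X *: 1)).
  by rewrite e2; reflexivity.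
have dE : \det Y * \det X = 1 + p ^+ k * z by rewrite mulrC -hz; ring.
move: e3; rewrite !scalerA dE.
have hs Z : congr_mx p k ((1 + p ^+ k * z) *: Z) Z.
  by exists (z *: Z); rewrite scalerDl scale1r addrC addKr scalerA.
by rewrite !hs.
Qed.

Lemma congr_mx_inv_uniq k X Y Y' :
  congr_mx p k (X *m Y) 1 -> congr_mx p k (X *m Y') 1 -> congr_mx p k Y Y'.
Proof.
move=> h /congr_mx1C h'.
rewrite -[Y]mul1mx -[1%:M]/(1 : 'M_2) -h' -mulmxA h mulmx1; reflexivity.
Qed.

Lemma congr_mx_conj_inv k c ci X Y : congr_mx p k (c *m ci) 1 ->
  congr_mx p k (c *m X) (Y *m c) ->
  congr_el p k (\tr X) (\tr Y) /\ congr_el p k (\det X) (\det Y).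
Proof.
move=> hc hX; have hc' := congr_mx1C hc.
have e : congr_mx p k X (ci *m Y *m c).
  by rewrite -mulmxA -hX mulmxA hc' mul1mx; reflexivity.
split.
  have : congr_mx p k (Y *m (c *m ci)) Y by rewrite hc mulmx1; reflexivity.
  move/congr_mx_tr; apply: congr_el_trans.
  by rewrite mulmxA mxtrace_mulC mulmxA; apply: congr_mx_tr.
apply: congr_el_trans (congr_mx_det e) _; rewrite !det_mulmx.
have := congr_mx_det hc; rewrite det_mulmx det1 => h.
by apply: (congr_el_comb1 (c1 := \det Y) h); ring.
Qed.

End CongrMx.

(** * The valuation ring: units, residues and square roots *)

Section Dvr.
Variables (O : idomainType) (pi : O).
Hypothesis hO : is_cdvr_odd pi.
Implicit Types (x y : O).

Lemma unit_or_congr0 x : x \is a GRing.unit \/ congr_el pi 1 x 0.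
Proof.
have [[_ _ h] _] := hO; have [->|/h [u [[|n] [hu ->]]]] := eqVneq x 0.
- by right; exact: congr_el_refl.
- by left; rewrite expr0 mulr1.
- by right; exists (u * pi ^+ n); rewrite exprS; ring.
Qed.

Lemma unit_ncongr0 x : x \is a GRing.unit -> ~ congr_el pi 1 x 0.
Proof.
have [[_ h _] _] := hO => hx [z]; rewrite subr0 expr1 => e.
by move: hx; rewrite e unitrM (negbTE h).
Qed.

Lemma two_unit : (2%:R : O) \is a GRing.unit.
Proof. by case: hO => _ []. Qed.

Lemma unit_mod_unit k x : (0 < k)%N -> unit_mod pi k x -> x \is a GRing.unit.
Proof.
move=> k0 [u /(congr_el_leq k0) hu]; case: (unit_or_congr0 x) => // hx.
case: (unit_ncongr0 (unitr1 O)).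
by apply: (congr_el_comb2 (c1 := -1) (c2 := u) hu hx); ring.
Qed.

Lemma congr_unit x y : congr_el pi 1 x y -> y \is a GRing.unit ->
  x \is a GRing.unit.
Proof.
move=> h hy; case: (unit_or_congr0 x) => // hx.
by case: (unit_ncongr0 hy); apply: (congr_el_comb2 (c1 := -1) (c2 := 1) h hx); ring.
Qed.

Lemma congr_el_cancel k u x y : u \is a GRing.unit ->
  congr_el pi k (u * x) (u * y) -> congr_el pi k x y.
Proof.
by move=> hu h; apply: (congr_el_comb1 (c1 := u^-1) h); rewrite -mulrBr mulKr.
Qed.

Lemma congr0_mul x y : congr_el pi 1 (x * y) 0 ->
  congr_el pi 1 x 0 \/ congr_el pi 1 y 0.
Proof.
move=> h; case: (unit_or_congr0 x) => hx; last by left.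
by right; apply: (congr_el_cancel hx); rewrite mulr0.
Qed.

(** If [x = u * pi ^+ n] with [u] a unit, divisibility by [pi ^+ n.+1] would make [pi] divide
    [u]. *)
Lemma congr0_all x : (forall n, congr_el pi n x 0) -> x = 0.
Proof.
have [[pi0 piu h] _] := hO => hx; have [//|/h [u [n [hu xE]]]] := eqVneq x 0.
have [z] := hx n.+1; rewrite subr0 xE exprS mulrC => e.
have {}e : u = pi * z.
  by apply: (mulfI (expf_neq0 n pi0)); rewrite e; ring.
by move: hu; rewrite e unitrM (negbTE piu).
Qed.

(* Hensel's lemma for [y ^ 2 - x], by Newton iteration. *)
Lemma square_mod1_square x : x \is a GRing.unit -> square_mod pi 1 x ->
  exists y, y * y = x.
Proof.
move=> hx [y0 hy0]; have h2 := two_unit.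
pose f y := y - (y * y - x) / (2%:R * y).
pose a n := iter n f y0.
have ha n : a n \is a GRing.unit /\ congr_el pi n.+1 (a n * a n) x.
  elim: n => [|n [hu [z hz]]].
    split=> //; case: (unit_or_congr0 y0) => // h.
    case: (unit_ncongr0 hx).
    by apply: (congr_el_comb2 (c1 := -1) (c2 := y0) hy0 h); ring.
  set w := z / (2%:R * a n).
  have fE : a n.+1 = a n - pi ^+ n.+1 * w.
    by rewrite /a /= -/(a n) /f hz /w; ring.
  have hw : z = 2%:R * a n * w by rewrite mulrC divrK // unitrM h2.
  split.
    by apply: (congr_unit (y := a n)) => //;
      exists (- (pi ^+ n * w)); rewrite fE exprS; ring.
  (* The linear terms cancel and the new error is [pi^(2n+2) w^2], from which the factor [pi^(n+2)]
     is taken out. *)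
  exists (pi ^+ n * w ^+ 2); rewrite fE -[x](subKr (a n * a n)) hz hw !exprS.
  by ring.
have [L hL] : exists L, forall n, congr_el pi n L (a n).
  have [_ [h _ _]] := hO; apply: h => n.
  have [hu [z hz]] := ha n; exists (- (pi * (z / (2%:R * a n)))).
  by rewrite /a /= -/(a n) /f hz exprS; ring.
exists L; apply/eqP; rewrite -subr_eq0; apply/eqP/congr0_all => n.
have [_ /(congr_el_leq (leqnSn n)) h] := ha n.
by apply: (congr_el_comb2 (c1 := 1) (c2 := L + a n) h (hL n)); ring.
Qed.

End Dvr.

(* With [X_i] = [slmx p_i q_i r_i] (below) standing for the two conjugates of
   [A_2] and [a = alpha_1], the element [s = x + y A_1] satisfies [s X_1 = X_2 s] exactly
   when the last two congruences hold; [det s = x^2 - e a y^2]. Two solutions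
   are visible from the equations, and if neither is invertible then
   [X_1 = r_1 A_1] modulo [pi]. *)
Lemma exists_intertwiner (O : idomainType) (pi : O) (k : nat)
    (e a p1 q1 r1 p2 q2 r2 : O) :
  is_cdvr_odd pi -> (0 < k)%N -> e \is a GRing.unit ->
  ~ square_mod pi 1 (e * a) ->
  congr_el pi k (p1 ^+ 2 + e * q1 * r1) (p2 ^+ 2 + e * q2 * r2) ->
  congr_el pi k (q1 + a * r1) (q2 + a * r2) ->
  ~ (congr_el pi 1 p1 0 /\ congr_el pi 1 q1 (a * r1)) ->
  exists x y, [/\ x ^+ 2 - e * a * y ^+ 2 \is a GRing.unit,
    congr_el pi k (x * (p1 - p2)) (e * y * (q2 - a * r1)) &
    congr_el pi k (x * (r1 - r2)) (- y * (p1 + p2))].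
Proof.
move=> hO k0 he hns hdet ht hne.
(* The form is anisotropic modulo [pi]: if [y] were a unit, [x / y] would be a square root of
   [e * a]. *)
have aniso x y : congr_el pi 1 (x ^+ 2 - e * a * y ^+ 2) 0 ->
    congr_el pi 1 x 0 /\ congr_el pi 1 y 0.
  move=> h; case: (unit_or_congr0 hO y) => hy.
    case: hns; exists (x / y).
    have E : e * a = y^-1 ^+ 2 * (e * a * y ^+ 2).
      by rewrite mulrCA -exprMn mulVr // expr1n mulr1.
    by apply: (congr_el_comb1 (c1 := y^-1 ^+ 2) h); rewrite {1}E; ring.
  have : congr_el pi 1 (x * x) 0.
    by apply: (congr_el_comb2 (c1 := 1) (c2 := e * a * y) h hy); ring.
  by case/(congr0_mul hO).
(* The two congruences form a homogeneous linear system in [x], [y], whose determinant vanishes by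
   [hdet] and [ht]. Each row has an evident kernel vector: [(p1 + p2, r2 - r1)] for the second row
   and [(e (q2 - a r1), p1 - p2)] for the first, and each solves the whole system. *)
case: (unit_or_congr0 hO ((p1 + p2) ^+ 2 - e * a * (r2 - r1) ^+ 2)) => [hu|].
  exists (p1 + p2), (r2 - r1); split=> //.
    apply: (congr_el_comb2 (c1 := 1) (c2 := - (e * r1)) hdet ht); ring.
  by apply: (congr_el_comb1 (c1 := 0) ht); ring.
case/aniso => hp hr.
case: (unit_or_congr0 hO ((e * (q2 - a * r1)) ^+ 2 - e * a * (p1 - p2) ^+ 2)) => [hu|].
  exists (e * (q2 - a * r1)), (p1 - p2); split=> //.
    by apply: (congr_el_comb1 (c1 := 0) ht); ring.
  apply: (congr_el_comb2 (c1 := 1) (c2 := - (e * r1)) hdet ht); ring.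
(* Both solutions vanish modulo [pi]: then [2 p1 = 0], [r1 = r2] and [q2 = a r1], so [ht] gives
   [q1 = a r1]. *)
case/aniso => hq hp'; case: hne; split.
  apply: (congr_el_cancel (two_unit hO)).
  by apply: (congr_el_comb2 (c1 := 1) (c2 := 1) hp hp'); ring.
have {}hq : congr_el pi 1 (q2 - a * r1) 0.
  by apply: (congr_el_cancel he); rewrite mulr0.
have {}ht := congr_el_leq k0 ht.
by apply: (congr_el_comb3 (c1 := 1) (c2 := a) (c3 := 1) ht hr hq); ring.
Qed.

(** * The argument common to both groups, from the properties of [G] and [g] that it uses *)

Section Generic.
Variables (O : idomainType) (pi : O) (R : comNzRingType)
  (emb : {rmorphism O -> R}) (eps : R) (e : O)
  (Gm gm : nat -> 'M[R]_2 -> Prop) (b : bool).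
Local Notation p := (emb pi).
Local Notation cmx := (congr_mx p).

(** A common shape for the trace-zero elements of [g]: three coordinates in [O], with [eps] carried
    by the off-diagonal entries. *)
Definition slmx (x y z : O) : 'M[R]_2 :=
  mx2 (emb x) (eps * emb y) (eps * emb z) (- emb x).

(** The type is read off [alpha] alone; [conj_par] below justifies this, since conjugacy to a normal
    form determines [alpha] modulo [p^k]. *)
Definition cus_par k (a : O) := a \is a GRing.unit /\
  (if b then ~ square_mod pi k a else square_mod pi k a).

Definition ss_par k (a : O) := a \is a GRing.unit /\
  (if b then square_mod pi k a else ~ square_mod pi k a).

Hypothesis hO : is_cdvr_odd pi.
Hypothesis he : e \is a GRing.unit.
Hypothesis heps : eps * eps = emb e.
Hypothesis emb_congr : forall k x,
  congr_el p k (emb x) 0 -> congr_el pi k x 0.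
Hypothesis Gm_congr : forall k X Y, cmx k X Y -> Gm k X -> Gm k Y.
Hypothesis Gm_mul : forall k X Y, Gm k X -> Gm k Y -> Gm k (X *m Y).
Hypothesis Gm_inv : forall k X, Gm k X -> exists2 Y, cmx k (X *m Y) 1 & Gm k Y.
Hypothesis conj_slmx : forall k g gi a, Gm k g -> cmx k (g *m gi) 1 ->
  gm k (mx2 0 (eps * a) eps 0) ->
  exists x y z, cmx k (g *m mx2 0 (eps * a) eps 0 *m gi) (slmx x y z).
Hypothesis cus_nonsquare : forall k a, (0 < k)%N -> cus_par k a ->
  ~ square_mod pi 1 (e * a).
Hypothesis cus_ss_sep : forall k a1 a2, (0 < k)%N ->
  cus_par k a1 -> ss_par k a2 -> forall r, ~ congr_el pi 1 a2 (a1 * (r * r)).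
(** The matrix is [x + y A_1]. The scalar [t] leaves room for the normalisation needed in the
    unitary group and does not affect commutation or intertwining. *)
Hypothesis cent_lift : forall l k a x y, (0 < k)%N -> cus_par k a ->
  x ^+ 2 - e * a * y ^+ 2 \is a GRing.unit ->
  exists s t, Gm l s /\
    cmx k s (t *: mx2 (emb x) (eps * emb (y * a)) (eps * emb y) (emb x)).

Lemma emb_congr_iff k x y : congr_el p k (emb x) (emb y) <-> congr_el pi k x y.
Proof.
split=> [h|[z hz]].
  have : congr_el pi k (x - y) 0.
    by apply/emb_congr; apply: (congr_el_comb1 (c1 := 1) h); rewrite rmorphB; ring.
  by move=> {}h; apply: (congr_el_comb1 (c1 := 1) h); ring.
by exists (emb z); rewrite -rmorphB hz rmorphM rmorphXn.
Qed.

Lemma eps_congr_iff k x y :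
  congr_el p k (eps * x) (eps * y) <-> congr_el p k x y.
Proof.
split=> h; last by apply: (congr_el_comb1 (c1 := eps) h); ring.
have hi : emb e^-1 * (eps * eps) = 1 by rewrite heps -rmorphM mulVr // rmorph1.
apply: (congr_el_comb1 (c1 := emb e^-1 * eps) h).
by rewrite -[LHS]mul1r -hi; ring.
Qed.

Lemma Gm_inv_mod k X Y : Gm k X -> cmx k (X *m Y) 1 -> Gm k Y.
Proof.
by move=> /Gm_inv [Y' hY' GY'] hY; apply: Gm_congr GY'; exact: congr_mx_inv_uniq hY' hY.
Qed.

Lemma psi_congr psi l x y : is_psi pi emb l psi ->
  congr_el p l x y -> psi x = psi y.
Proof.
move=> [_ psiD psil _] [z hz].
by rewrite -(subrK y x) psiD hz psil mul1r.
Qed.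

Lemma congr_mx_scale_exp m k X Y :
  cmx k X Y -> cmx (m + k) (p ^+ m *: X) (p ^+ m *: Y).
Proof. by move=> [Z hZ]; exists Z; rewrite -scalerBr hZ scalerA exprD. Qed.

Lemma uphalfDhalf l : (uphalf l + l./2)%N = l.
Proof. by rewrite uphalf_half -addnA addnn odd_double_half. Qed.

(** Cyclicity of the trace moves the conjugation by [s] from [B] to [A]. The factor [p ^+ uphalf l]
    raises commutation modulo [p ^+ l./2] to a congruence modulo [p ^+ l], which is all that [psi]
    sees. *)
Lemma stab_of_commute psi l A s : is_psi pi emb l psi -> Gm l s ->
  cmx l./2 (s *m A) (A *m s) -> stab pi emb Gm psi l A s.
Proof.
move=> hpsi Gs hs; split=> //; have [si hsi _] := Gm_inv Gs.
exists si; split=> // B B' _ hB; rewrite /psiA; apply: psi_congr hpsi _.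
set P := p ^+ uphalf l in hB *.
have hB' : cmx l (P *: B') (P *: (s *m B *m si)).
  apply: congr_mx_sym; move: hB.
  rewrite mulmxDr mulmxDl mulmx1 hsi -scalemxAr -scalemxAl => /congr_mx_sym h.
  have := congr_mx_add (congr_mx_refl p l (-1)) h.
  by rewrite !addKr; exact: congr_mx_sym.
have hA := congr_mx_scale_exp (uphalf l) hs; rewrite uphalfDhalf in hA.
rewrite -!mxtraceZ; apply: (congr_el_trans (y := \tr (P *: (A *m s) *m (B *m si)))).
  apply: congr_mx_tr; rewrite scalemxAr hB' -scalemxAr -scalemxAl !mulmxA.
  reflexivity.
apply: (congr_el_trans (y := \tr (si *m s *m (P *: (A *m B))))).
  have -> : \tr (si *m s *m (P *: (A *m B))) = \tr (P *: (s *m A) *m (B *m si)).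
    by rewrite -mulmxA mxtrace_mulC -scalemxAr -!scalemxAl !mulmxA.
  by apply: congr_mx_tr; rewrite hA; reflexivity.
apply: congr_mx_tr; rewrite (congr_mx1C hsi) mul1mx; reflexivity.
Qed.

Lemma stab_mul psi l A s t : stab pi emb Gm psi l A s ->
  stab pi emb Gm psi l A t -> stab pi emb Gm psi l A (s *m t).
Proof.
move=> [Gs [si [hsi hs]]] [Gt [ti [hti ht]]]; split; first exact: Gm_mul.
rewrite /inv_mod in hsi hti *.
exists (ti *m si); split.
  rewrite mulmxA -(mulmxA s) hti mulmx1; exact: hsi.
move=> B B' GB hB; set P := p ^+ uphalf l in hB GB hs ht *.
have hB2 : cmx l (t *m (1 + P *: B) *m ti) (1 + P *: (t *m B *m ti)).
  rewrite mulmxDr mulmxDl mulmx1 hti -scalemxAr -scalemxAl; reflexivity.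
(* The condition on [s] is applied to the conjugate by [t], so this conjugate has to lie in [G] as
   well. *)
rewrite -(ht _ _ GB hB2); apply: hs; last first.
  by rewrite -hB2 -hB !mulmxA; reflexivity.
apply: Gm_congr hB2 _; apply: Gm_mul; first exact: Gm_mul.
exact: Gm_inv_mod Gt hti.
Qed.

Lemma dcoset_sub psi l A1 A2 g h s1 s2 x :
  stab pi emb Gm psi l A1 s1 -> stab pi emb Gm psi l A2 s2 ->
  cmx l h (s1 *m g *m s2) -> dcoset pi emb Gm psi l A1 A2 h x ->
  dcoset pi emb Gm psi l A1 A2 g x.
Proof.
move=> hs1 hs2 hh [Gx [t1 [t2 [ht1 [ht2 hx]]]]]; split=> //.
exists (t1 *m s1), (s2 *m t2); split; first exact: stab_mul.
by split; [exact: stab_mul|rewrite hx hh !mulmxA; reflexivity].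
Qed.

(** With [s] in the centralizer of [A_1] intertwining the two conjugates of [A_2], take [s1 = s] and
    [s2 = g^-1 s^-1 h]. The factorization of [h] then holds modulo [p^l], while the commutations
    hold modulo [p^k] only. *)
Lemma double_coset_rep l k (a1 a2 : O) (t1 t2 : R) g h gi hi :
  let A1 := mx2 0 (eps * t1) eps 0 in let A2 := mx2 0 (eps * t2) eps 0 in
  (0 < k <= l)%N -> cus_par k a1 -> ss_par k a2 \/ congr_el pi 1 a2 0 ->
  congr_el p k t1 (emb a1) -> congr_el p k t2 (emb a2) -> gm l A2 ->
  Gm l g -> Gm l h -> cmx l (g *m gi) 1 -> cmx l (h *m hi) 1 ->
  congr_el p k (\det (A1 + g *m A2 *m gi)) (\det (A1 + h *m A2 *m hi)) ->
  exists s1 s2, [/\ Gm l s1, Gm l s2, cmx k (s1 *m A1) (A1 *m s1),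
    cmx k (s2 *m A2) (A2 *m s2) & cmx l h (s1 *m g *m s2)].
Proof.
move=> A1 A2 /andP[k0 kl] ha1 ha2 ht1 ht2 gA2 Gg Gh hgi hhi hdet.
have [p1 [q1 [r1 /(congr_mx_leq kl) hB1]]] := conj_slmx Gg hgi gA2.
have [p2 [q2 [r2 /(congr_mx_leq kl) hB2]]] := conj_slmx Gh hhi gA2.
have A2E : cmx k A2 (slmx 0 a2 1).
  apply/congr_mx2; rewrite rmorph0 rmorph1 oppr0 mulr1.
  split; try exact: congr_el_refl.
  exact/eps_congr_iff.
have A1E : cmx k A1 (slmx 0 a1 1).
  apply/congr_mx2; rewrite rmorph0 rmorph1 oppr0 mulr1.
  split; try exact: congr_el_refl.
  exact/eps_congr_iff.
have det_slmx x y z : \det (slmx x y z) = - emb (x ^+ 2 + e * y * z).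
  rewrite det_mx2 rmorphD rmorphXn 2!rmorphM -heps; ring.
have detB u ui x y z : cmx l (u *m ui) 1 ->
    cmx k (u *m A2 *m ui) (slmx x y z) ->
    congr_el pi k (x ^+ 2 + e * y * z) (e * a2).
  move=> /(congr_mx_leq kl) hu hB; apply/emb_congr_iff.
  have hc : cmx k (u *m A2) (slmx x y z *m u).
    by rewrite -hB -!mulmxA (congr_mx1C hu) mulmx1; reflexivity.
  have [_ h1] := congr_mx_conj_inv hu hc.
  have := congr_el_trans (congr_el_sym (congr_mx_det A2E)) h1.
  rewrite !det_slmx => h2.
  apply: (congr_el_comb1 (c1 := 1) h2); rewrite expr0n /= add0r mulr1; ring.
have hd1 := detB _ _ _ _ _ hgi hB1; have hd2 := detB _ _ _ _ _ hhi hB2.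
have addE x y z : slmx 0 a1 1 + slmx x y z = slmx x (a1 + y) (1 + z).
  by rewrite addmx2; congr mx2; rewrite ?rmorphD ?rmorph0; ring.
(* Minus the determinant of [A_1 + X] is [(p^2 + e q r) + e (q + a1 r) + e a1]. The first term is
   the same for both conjugates, so the trace pairing with [A_1] agrees as well. *)
have ht : congr_el pi k (q1 + a1 * r1) (q2 + a1 * r2).
  have h1 : congr_el p k (\det (slmx 0 a1 1 + slmx p1 q1 r1))
                         (\det (slmx 0 a1 1 + slmx p2 q2 r2)).
    apply: congr_el_trans (congr_el_trans _ hdet) _; apply: congr_mx_det.
      by rewrite A1E hB1; reflexivity.
    by rewrite A1E hB2; reflexivity.
  have {}h1 : congr_el pi k (p1 ^+ 2 + e * (a1 + q1) * (1 + r1))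
                         (p2 ^+ 2 + e * (a1 + q2) * (1 + r2)).
    apply/emb_congr_iff; move: h1; rewrite !addE !det_slmx => h1.
    by apply: (congr_el_comb1 (c1 := -1) h1); ring.
  apply: (congr_el_cancel he).
  by apply: (congr_el_comb3 (c1 := 1) (c2 := -1) (c3 := 1) h1 hd1 hd2); ring.
(* Otherwise the conjugate is [r1 A_1] modulo [pi], and determinants give [a2 = a1 r1^2]. Type [ss]
   excludes this by square classes. For [sns] it forces [r1 = 0], hence [A_2 = 0] modulo [pi],
   although its entry [eps] has unit square. *)
have hne : ~ (congr_el pi 1 p1 0 /\ congr_el pi 1 q1 (a1 * r1)).
  case=> hp hq.
  have hr : congr_el pi 1 a2 (a1 * (r1 * r1)).
    apply: (congr_el_cancel he); have {}hd1 := congr_el_leq k0 hd1.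
    apply: (congr_el_comb3 (c1 := -1) (c2 := p1) (c3 := e * r1) hd1 hp hq); ring.
  case: ha2 => [ha2|ha2]; first exact: (cus_ss_sep k0 ha1 ha2) hr.
  have r10 : congr_el pi 1 r1 0.
    have : congr_el pi 1 (r1 * r1) 0.
      apply: (congr_el_cancel (proj1 ha1)).
      by apply: (congr_el_comb2 (c1 := -1) (c2 := 1) hr ha2); ring.
    by case/(congr0_mul hO).
  have hB : cmx 1 (g *m A2 *m gi) 0.
    apply: congr_mx_trans (congr_mx_leq k0 hB1) _; rewrite mx2_0.
    have q10 : congr_el pi 1 q1 0.
      by apply: (congr_el_comb2 (c1 := 1) (c2 := a1) hq r10); ring.
    move/emb_congr_iff: q10; move/emb_congr_iff: r10; move/emb_congr_iff: hp.
    rewrite rmorph0 => h1 h2 h3; apply/congr_mx2; split=> //.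
    - by apply: (congr_el_comb1 (c1 := eps) h3); ring.
    - by apply: (congr_el_comb1 (c1 := eps) h2); ring.
    - by apply: (congr_el_comb1 (c1 := -1) h1); ring.
  have hg := congr_mx1C (congr_mx_leq (leq_trans k0 kl) hgi).
  have : cmx 1 A2 0.
    have E : cmx 1 A2 (gi *m (g *m A2 *m gi) *m g).
      by rewrite !mulmxA hg mul1mx -mulmxA hg mulmx1; reflexivity.
    by rewrite E hB mulmx0 mul0mx; reflexivity.
  rewrite mx2_0 => /congr_mx2 [_ _ heps0 _].
  apply: (unit_ncongr0 hO he); apply/emb_congr_iff; rewrite -heps rmorph0.
  by apply: (congr_el_comb1 (c1 := eps) heps0); ring.
have hdd : congr_el pi k (p1 ^+ 2 + e * q1 * r1) (p2 ^+ 2 + e * q2 * r2).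
  exact: congr_el_trans hd1 (congr_el_sym hd2).
have [x [y [hu hx hy]]] :=
  exists_intertwiner hO k0 he (cus_nonsquare k0 ha1) hdd ht hne.
have [s [t [Gs hs]]] := cent_lift l k0 ha1 hu.
set S := mx2 _ _ _ _ in hs.
have SB : cmx k (S *m slmx p1 q1 r1) (slmx p2 q2 r2 *m S).
  rewrite /S /slmx !mulmx2; apply/congr_mx2.
  (* The first column of the matrix congruence is [hx] and [hy]; the second column is [hy'] and
     [hx'], which follow by means of [ht]. *)
  have hx' : congr_el pi k (x * (p2 - p1)) (e * y * (a1 * r2 - q1)).
    by apply: (congr_el_comb2 (c1 := -1) (c2 := e * y) hx ht); ring.
  have hy' : congr_el pi k (x * (q1 - q2)) (y * a1 * (p1 + p2)).
    by apply: (congr_el_comb2 (c1 := - a1) (c2 := x) hy ht); ring.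
  move/emb_congr_iff: hx; move/emb_congr_iff: hy.
  move/emb_congr_iff: hx'; move/emb_congr_iff: hy'.
  rewrite !(rmorphM, rmorphD, rmorphN) -heps => h1 h2 h3 h4; split.
  - by apply: (congr_el_comb1 (c1 := 1) h4); ring.
  - by apply: (congr_el_comb1 (c1 := eps) h1); ring.
  - by apply: (congr_el_comb1 (c1 := eps) h3); ring.
  - by apply: (congr_el_comb1 (c1 := 1) h2); ring.
have SA : S *m slmx 0 a1 1 = slmx 0 a1 1 *m S.
  by rewrite /S /slmx !mulmx2; congr mx2; rewrite ?(rmorphM, rmorph0, rmorph1); ring.
have sA : cmx k (s *m A1) (A1 *m s).
  by rewrite hs A1E -scalemxAl -scalemxAr SA; reflexivity.
have sB : cmx k (s *m (g *m A2 *m gi)) (h *m A2 *m hi *m s).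
  by rewrite hs hB1 hB2 -scalemxAl -scalemxAr SB; reflexivity.
have [si hsi Gsi] := Gm_inv Gs.
(* Commutation of the second witness with [A_2] is [sB] rewritten: the conjugate by [h] is the
   conjugate by [s] of the conjugate by [g]. *)
exists s, (gi *m (si *m h)); split=> //.
- by apply: Gm_mul (Gm_inv_mod Gg hgi) (Gm_mul Gsi Gh).
- have hg := congr_mx1C (congr_mx_leq kl hgi).
  have hh := congr_mx1C (congr_mx_leq kl hhi).
  have hsk := congr_mx_leq kl hsi; have hsk' := congr_mx1C hsk.
  have E1 : cmx k (h *m A2) (h *m A2 *m hi *m h).
    by rewrite -(mulmxA _ hi) hh mulmx1; reflexivity.
  have E2 : cmx k (h *m A2 *m hi) (s *m (g *m A2 *m gi) *m si).
    by rewrite sB -(mulmxA _ s) hsk mulmx1; reflexivity.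
  have -> : gi *m (si *m h) *m A2 = gi *m (si *m (h *m A2)) by rewrite !mulmxA.
  rewrite E1 E2 !mulmxA -(mulmxA gi si s) hsk' mulmx1 hg mul1mx; reflexivity.
- rewrite !mulmxA -(mulmxA s g gi) hgi mulmx1 hsi mul1mx; reflexivity.
Qed.

Lemma thm6p10_generic_holds : thm6p10_generic pi emb eps Gm gm b.
Proof.
move=> l psi a1 a2 t1 t2 hl hpsi A1 A2 At1 At2 _ _ gt1 gt2 ht1 ht2 cusA1 typA2 g Gg.
set k := l./2 in ht1 ht2 cusA1 typA2.
have k0 : (0 < k)%N by rewrite half_gt0.
have kl : (k <= l)%N by rewrite /k -{2}(uphalfDhalf l) leq_addl.
have [gi hgi Ggi] := Gm_inv Gg.
have G1 : Gm l 1 by apply: Gm_congr hgi _; exact: Gm_mul.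
(* The case [g = 1] of [conj_slmx] shows that the parameter comes from [O] modulo [p^l]. *)
have par t : gm l (mx2 0 (eps * t) eps 0) -> exists a, congr_el p l t (emb a).
  move=> gt; have h1 : cmx l (1 *m 1) 1 by rewrite mulmx1; reflexivity.
  have [x [y [z]]] := conj_slmx G1 h1 gt.
  by rewrite mul1mx mulmx1 => /congr_mx2 [_ /eps_congr_iff h _ _]; exists y.
have [c1 /(congr_el_leq kl) hc1] := par _ gt1.
have [c2 /(congr_el_leq kl) hc2] := par _ gt2.
have h2 : emb (2%:R^-1) * 2%:R = 1.
  by rewrite -(rmorph_nat emb) -rmorphM mulVr ?rmorph1 //; exact: two_unit hO.
(* Equal traces give [2 x = 0], hence [x = 0] since 2 is a unit; the determinants then compare [t]
   with [z]. *)
have conj_par (x t z : R) : conj_mod pi emb Gm k k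
    (mx2 0 (eps * t) eps 0) (mx2 x (eps * z) eps x) -> congr_el p k t z.
  move=> [c [/Gm_inv [ci hci _] hc]].
  have [] := congr_mx_conj_inv hci hc; rewrite !mxtrace2 !det_mx2 => htr hdet.
  have hx : congr_el p k x 0.
    apply: (congr_el_comb1 (c1 := - emb (2%:R^-1)) htr).
    rewrite subr0 -[LHS]mul1r -h2; ring.
  apply: (proj1 (eps_congr_iff _ _ _)); apply: (proj1 (eps_congr_iff _ _ _)).
  by apply: (congr_el_comb2 (c1 := -1) (c2 := - x) hdet hx); ring.
have cus1 : cus_par k c1.
  have [x [sg [/(unit_mod_unit hO k0) usg [hsg /conj_par h]]]] := cusA1.
  have hcs : congr_el pi k c1 sg.
    apply/emb_congr_iff; apply: congr_el_trans h.
    exact: congr_el_trans (congr_el_sym hc1) ht1.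
  split; first exact: (congr_unit hO (congr_el_leq k0 hcs) usg).
  move: hsg; case: b => [hn [y hy]|[y hy]].
    by apply: hn; exists y; exact: congr_el_trans hy hcs.
  by exists y; exact: congr_el_trans hy (congr_el_sym hcs).
have ss2 : ss_par k c2 \/ congr_el pi 1 c2 0.
  case: typA2 => [|[x [be]]].
    move=> [x [sg [/(unit_mod_unit hO k0) usg [hsg /conj_par h]]]]; left.
    have hcs : congr_el pi k c2 sg.
      apply/emb_congr_iff; apply: congr_el_trans h.
      exact: congr_el_trans (congr_el_sym hc2) ht2.
    split; first exact: (congr_unit hO (congr_el_leq k0 hcs) usg).
    move: hsg; case: b => [[y hy]|hn [y hy]].
      by exists y; exact: congr_el_trans hy (congr_el_sym hcs).
    by apply: hn; exists y; exact: congr_el_trans hy hcs.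
  rewrite -mulrA => /conj_par h; right; apply/emb_congr_iff.
  have h3 : congr_el p 1 (emb c2) (p * be).
    apply: (congr_el_leq k0); apply: congr_el_trans h.
    exact: congr_el_trans (congr_el_sym hc2) ht2.
  apply: congr_el_trans h3 _; exists be; rewrite rmorph0; ring.
have A1E : cmx k At1 A1.
  apply/congr_mx2; split; try exact: congr_el_refl; exact/eps_congr_iff.
have A2E : cmx k At2 A2.
  apply/congr_mx2; split; try exact: congr_el_refl; exact/eps_congr_iff.
have key u v ui vi x : Gm l u -> Gm l v ->
    cmx l (u *m ui) 1 -> cmx l (v *m vi) 1 ->
    congr_el p k (\det (At1 + u *m At2 *m ui)) (\det (At1 + v *m At2 *m vi)) ->
    dcoset pi emb Gm psi l A1 A2 v x -> dcoset pi emb Gm psi l A1 A2 u x.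
  move=> Gu Gv hu hv hdet.
  have kkl : (0 < k <= l)%N by rewrite k0.
  have [s1 [s2 [Gs1 Gs2]]] :=
    double_coset_rep kkl cus1 ss2 hc1 hc2 gt2 Gu Gv hu hv hdet.
  rewrite -/At1 -/At2 A1E A2E => hs1 hs2 hE.
  by apply: dcoset_sub hE; exact: stab_of_commute.
(* The class of [g] itself is the one element. Conjugacy of the sums enters through their
   determinants, and [key] applied in both directions gives the two inclusions. *)
exists g; split.
  split=> //; exists gi, gi; split=> //; split=> //.
  by exists 1; split=> //; rewrite mul1mx mulmx1; reflexivity.
move=> h [Gh [ui [hi [hu [hh [c [/Gm_inv [ci /(congr_mx_leq kl) hci _] hc]]]]]]] x.
have [_ hdet] := congr_mx_conj_inv hci hc.
split; first exact: key hdet.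
exact: key (congr_el_sym hdet).
Qed.

End Generic.

(** * Square classes of units *)

Section SquareClasses.
Variables (O : idomainType) (pi : O).
Hypothesis hO : is_cdvr_odd pi.

Lemma square_mod1_div (a c r : O) : a \is a GRing.unit ->
  c \is a GRing.unit -> congr_el pi 1 c (a * (r * r)) ->
  square_mod pi 1 c <-> square_mod pi 1 a.
Proof.
move=> ua uc h.
have ur : r \is a GRing.unit.
  by have := congr_unit hO (congr_el_sym h) uc; rewrite !unitrM => /and3P[].
split=> -[y hy]; last first.
  exists (y * r); apply: (congr_el_comb2 (c1 := r * r) (c2 := -1) hy h); ring.
exists (y / r); have E : a = r^-1 ^+ 2 * (a * (r * r)).
  by rewrite mulrCA -expr2 -exprMn mulVr // expr1n mulr1.
apply: (congr_el_comb2 (c1 := r^-1 ^+ 2) (c2 := r^-1 ^+ 2) hy h).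
by rewrite {1}E; ring.
Qed.

(** By Hensel's lemma, a unit that is a square modulo [pi] is a square in [O], hence modulo every
    power. *)
Lemma square_mod_unit k (a : O) : (0 < k)%N -> a \is a GRing.unit ->
  square_mod pi k a <-> square_mod pi 1 a.
Proof.
move=> k0 ua; split=> [[y hy]|/(square_mod1_square hO ua) [y <-]].
  by exists y; exact: congr_el_leq hy.
by exists y; exact: congr_el_refl.
Qed.

(** The congruence would put [a1] and [a2] in one square class modulo [pi], whereas the two types
    require opposite classes for either value of [b]. *)
Lemma cus_ss_separated b k a1 a2 : (0 < k)%N ->
  cus_par pi b k a1 -> ss_par pi b k a2 ->
  forall r, ~ congr_el pi 1 a2 (a1 * (r * r)).
Proof.
move=> k0 [u1 h1] [u2 h2] r /(square_mod1_div u1 u2) h.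
have e1 := square_mod_unit k0 u1; have e2 := square_mod_unit k0 u2.
by case: b h1 h2 => h1 h2; tauto.
Qed.

End SquareClasses.

(** * The general linear group *)

Section GL.
Variables (O : idomainType) (pi : O).
Hypothesis hO : is_cdvr_odd pi.

Lemma thm6p10_GL_holds : thm6p10_GL pi.
Proof.
apply: (@thm6p10_generic_holds O pi O idfun 1 1 (GL_G pi) (@GL_g O) true) => //.
- exact: unitr1.
- by rewrite mulr1.
- move=> k X Y hXY [Z hZ]; exists Z; rewrite -hXY; exact: hZ.
- move=> k X Y [X' hX] [Y' hY]; exists (Y' *m X').
  rewrite mulmxA -(mulmxA X) hY mulmx1; exact: hX.
- by move=> k X [Y hY]; exists Y => //; exists X; exact: congr_mx1C.
- move=> k g gi a _ hg _; set A := mx2 _ _ _ _; set B := _ *m gi.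
  have hc : congr_mx pi k (g *m A) (B *m g).
    by rewrite /B -mulmxA (congr_mx1C hg) mulmx1; reflexivity.
  have [+ _] := congr_mx_conj_inv hg hc.
  rewrite mxtrace2 [X in \tr X]mx2_eta mxtrace2 => htr.
  exists (B 0 0), (B 0 1), (B 1 0); rewrite [X in congr_mx _ _ X]mx2_eta.
  apply/congr_mx2; rewrite !mul1r /=; split; try exact: congr_el_refl.
  by apply: (congr_el_comb1 (c1 := -1) htr); ring.
- move=> k a k0 [ua h]; rewrite mul1r => h'; apply: h.
  exact/(square_mod_unit hO k0 ua).
- exact: cus_ss_separated.
(* Here [x + y A_1] is already in the group, so [t = 1]; its inverse is [(x - y A_1) / D]. *)
- move=> l k a x y k0 [ua _]; set D := _ - _ => uD.
  exists (mx2 x (y * a) y x), 1; split; last first.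
    by rewrite scale1r !mul1r; reflexivity.
  exists (D^-1 *: mx2 x (- (y * a)) (- y) x).
  rewrite -scalemxAr mulmx2 scalemx2 mx2_1; apply/congr_mx2.
  have DE : D^-1 * (x ^+ 2 - 1 * a * y ^+ 2) = 1 by rewrite mulVr.
  split.
  - by exists 0; rewrite -[1 in LHS]DE; ring.
  - by exists 0; ring.
  - by exists 0; ring.
  - by exists 0; rewrite -[1 in LHS]DE; ring.
Qed.

End GL.

(** * The unitary group over the quadratic extension *)

Section GU.
Variables (O : idomainType) (pi d : O).
Local Notation Q := (quad d).
Local Notation P := (qemb d pi).
Local Notation theta := (qtheta d).

Lemma quad_eqP (x y : Q) : qa x = qa y -> qb x = qb y -> x = y.
Proof. by case: x y => [a1 b1] [a2 b2] /= -> ->. Qed.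

Lemma qaD (x y : Q) : qa (x + y) = qa x + qa y. Proof. by []. Qed.
Lemma qbD (x y : Q) : qb (x + y) = qb x + qb y. Proof. by []. Qed.
Lemma qaN (x : Q) : qa (- x) = - qa x. Proof. by []. Qed.
Lemma qbN (x : Q) : qb (- x) = - qb x. Proof. by []. Qed.
Lemma qaM (x y : Q) : qa (x * y) = qa x * qa y + d * (qb x * qb y).
Proof. by []. Qed.
Lemma qbM (x y : Q) : qb (x * y) = qa x * qb y + qb x * qa y. Proof. by []. Qed.
Lemma qa1 : qa (1 : Q) = 1. Proof. by []. Qed.
Lemma qb1 : qb (1 : Q) = 0. Proof. by []. Qed.
Lemma qa0 : qa (0 : Q) = 0. Proof. by []. Qed.
Lemma qb0 : qb (0 : Q) = 0. Proof. by []. Qed.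
Definition quadE := (qaD, qbD, qaN, qbN, qaM, qbM, qa1, qb1, qa0, qb0).

Lemma qemb_zmod : zmod_morphism (@qemb O d).
Proof. by move=> x y; apply: quad_eqP; rewrite ?quadE /= ?subr0. Qed.
Lemma qemb_monoid : monoid_morphism (@qemb O d).
Proof. by split=> // x y; apply: quad_eqP; rewrite ?quadE /=; ring. Qed.
HB.instance Definition _ := GRing.isZmodMorphism.Build O Q (@qemb O d) qemb_zmod.
HB.instance Definition _ := GRing.isMonoidMorphism.Build O Q (@qemb O d) qemb_monoid.

Lemma qconj_zmod : zmod_morphism (@qconj O d).
Proof. by move=> x y; apply: quad_eqP; rewrite ?quadE /= ?quadE //; ring. Qed.
Lemma qconj_monoid : monoid_morphism (@qconj O d).
Proof.
by split=> [|x y]; apply: quad_eqP; rewrite ?quadE /= ?quadE //; ring.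
Qed.
HB.instance Definition _ := GRing.isZmodMorphism.Build Q Q (@qconj O d) qconj_zmod.
HB.instance Definition _ := GRing.isMonoidMorphism.Build Q Q (@qconj O d) qconj_monoid.

Lemma qconjK : involutive (@qconj O d).
Proof. by move=> x; apply: quad_eqP; rewrite /= ?opprK. Qed.

Lemma congr_quadP k (x y : Q) : congr_el P k x y <->
  congr_el pi k (qa x) (qa y) /\ congr_el pi k (qb x) (qb y).
Proof.
split=> [[z hz]|[[z1 h1] [z2 h2]]].
  move: hz; rewrite -rmorphXn => hz; split.
    by exists (qa z); rewrite -qaN -qaD hz qaM /=; ring.
  by exists (qb z); rewrite -qbN -qbD hz qbM /=; ring.
by exists (Quad z1 z2); rewrite -rmorphXn; apply: quad_eqP;
  rewrite !quadE /= ?h1 ?h2; ring.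
Qed.

Lemma congr_qconj k (x y : Q) :
  congr_el P k x y -> congr_el P k (qconj x) (qconj y).
Proof.
move=> /congr_quadP [h1 h2]; apply/congr_quadP; split=> //=.
by apply: (congr_el_comb1 (c1 := -1) h2); ring.
Qed.

(** Conjugation by [W] turns the transpose into reflection in the antidiagonal, so the off-diagonal
    entries keep their places. *)
Lemma ustar_mx2 (a b c e : Q) :
  ustar (mx2 a b c e) = mx2 (qconj e) (qconj b) (qconj c) (qconj a).
Proof.
rewrite /ustar.
have -> : (map_mx (@qconj O d) (mx2 a b c e))^T =
    mx2 (qconj a) (qconj c) (qconj b) (qconj e).
  by rewrite [LHS]mx2_eta !mxE.
by rewrite /Wmx !mulmx2; congr mx2; ring.
Qed.

Lemma ustarM (X Y : 'M[Q]_2) : ustar (X *m Y) = ustar Y *m ustar X.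
Proof.
rewrite (mx2_eta X) (mx2_eta Y) !(mulmx2, ustar_mx2) !(rmorphD, rmorphM) /=.
by congr mx2; ring.
Qed.

Lemma ustarK : involutive (@ustar O d).
Proof. by move=> X; rewrite (mx2_eta X) !ustar_mx2 !qconjK. Qed.

#[local] Instance congr_ustar k :
  Proper (congr_mx P k ==> congr_mx P k) (@ustar O d).
Proof.
move=> X Y; rewrite (mx2_eta X) (mx2_eta Y) !ustar_mx2 => /congr_mx2 [h1 h2 h3 h4].
by apply/congr_mx2; split; exact: congr_qconj.
Qed.

Hypothesis hO : is_cdvr_odd pi.
Hypothesis ud : d \is a GRing.unit.
Hypothesis dns : ~ (exists y : O, y * y = d).

Lemma d_nonsquare_mod1 : ~ square_mod pi 1 d.
Proof. by move/(square_mod1_square hO ud). Qed.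

Lemma thm6p10_GU_holds : thm6p10_GU pi d.
Proof.
have h2 := two_unit hO.
apply: (@thm6p10_generic_holds O pi Q (@qemb O d) theta d
  (GU_G pi (d:=d)) (GU_g pi (d:=d)) false) => //.
- by apply: quad_eqP; rewrite !quadE /=; ring.
- by move=> k x /congr_quadP [].
- move=> k X Y hXY hX; rewrite /GU_G -hXY; exact: hX.
- move=> k X Y hX hY; rewrite /GU_G ustarM mulmxA -(mulmxA _ (ustar X)).
  rewrite /GU_G in hX hY; rewrite hX mulmx1; exact: hY.
- move=> k X hX; exists (ustar X); first exact: congr_mx1C.
  by rewrite /GU_G ustarK; exact: congr_mx1C.
- move=> k g gi a hG hg hA; set A := mx2 _ _ _ _ in hA *; set B := _ *m gi.
  have hc : congr_mx P k (g *m A) (B *m g).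
    by rewrite /B -mulmxA (congr_mx1C hg) mulmx1; reflexivity.
  have [+ _] := congr_mx_conj_inv hg hc.
  (* Since [g^-1] is the star of [g], the conjugate [B] is again anti-self-adjoint. Its off-diagonal
     entries are therefore in [theta O], and trace zero together with invertibility of 2 puts the
     diagonal in [O]. *)
  have BS : congr_mx P k (ustar B) (-1 *: B).
    have hgi : congr_mx P k gi (ustar g).
      exact: congr_mx_inv_uniq hg (congr_mx1C hG).
    have hAs : congr_mx P k (ustar A) (-1 *: A).
      have := congr_mx_add (congr_mx_refl P k (-1 *: A)) hA.
      by rewrite addr0 addrA scaleN1r addNr add0r.
    rewrite /B !ustarM hAs hgi ustarK -hgi.
    by rewrite -!scalemxAl -!scalemxAr -!mulmxA; reflexivity.
  rewrite (mx2_eta B) in BS *; rewrite !mxtrace2 => htr.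
  move: BS; rewrite ustar_mx2 scalemx2 => /congr_mx2 [b1 b2 b3 _].
  move: (B 0 0) (B 0 1) (B 1 0) (B 1 1) b1 b2 b3 htr => x y z t.
  move=> /congr_quadP[b1 b1'] /congr_quadP[b2 b2'] /congr_quadP[b3 b3'].
  move=> /congr_quadP[h1 h1'].
  move: b1 b1' b2 b2' b3 b3' h1 h1'; rewrite !quadE /= => b1 b1' b2 b2' b3 b3' h1 h1'.
  exists (qa x), (qb y), (qb z); apply/congr_mx2.
  have x0 : congr_el pi k (qb x) 0.
    apply: (congr_el_cancel h2).
    by apply: (congr_el_comb2 (c1 := 1) (c2 := -1) b1' h1'); rewrite /=; ring.
  have y0 : congr_el pi k (qa y) 0.
    by apply: (congr_el_cancel h2);
      apply: (congr_el_comb1 (c1 := 1) b2); rewrite /=; ring.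
  have z0 : congr_el pi k (qa z) 0.
    by apply: (congr_el_cancel h2);
      apply: (congr_el_comb1 (c1 := 1) b3); rewrite /=; ring.
  split; apply/congr_quadP; rewrite !quadE /=; split.
  + exact: congr_el_refl.
  + exact: x0.
  + by apply: (congr_el_comb1 (c1 := 1) y0); ring.
  + by exists 0; ring.
  + by apply: (congr_el_comb1 (c1 := 1) z0); ring.
  + by exists 0; ring.
  + by apply: (congr_el_comb1 (c1 := -1) h1); ring.
  + by apply: (congr_el_comb2 (c1 := -1) (c2 := -1) h1' x0); ring.
(* A cuspidal [a] is a square here, so [d * a] lies in the class of [d], a non-square modulo [pi] by
   Hensel's lemma. *)
- move=> k a k0 [ua [y /(congr_el_leq k0) hy]] hs; apply: d_nonsquare_mod1.
  have uda : d * a \is a GRing.unit by rewrite unitrM ud.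
  apply/(square_mod1_div hO (a := d) (c := d * a) (r := y)) => //.
  by apply: (congr_el_comb1 (c1 := - d) hy); ring.
- exact: cus_ss_separated.
- (* As [a = tau^2], [det (x + y A_1)] is the norm of [x + y tau theta]:
     dividing by this element makes [x + y A_1] unitary. *)
  move=> l k a x y k0 [ua [tau htau]] hu.
  (* Only modulo [pi^k] is [a] equal to [tau^2]. Building everything from [tau^2] makes [t *: S]
     exactly unitary, hence unitary modulo [p^l]. *)
  set D := x ^+ 2 - d * (tau * tau) * y ^+ 2.
  have uD : D \is a GRing.unit.
    apply: (congr_unit hO _ hu); have h := congr_el_leq k0 htau.
    by apply: (congr_el_comb1 (c1 := - d * y ^+ 2) h); rewrite /D; ring.
  (* This square is the diagonal entry of the unitarity relation: one factor [x^2 - d tau^2 y^2]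
     comes from the norm of [t], the other from [S]. *)
  have DE : (D^-1 * (x ^+ 2 - d * (tau * tau) * y ^+ 2)) ^+ 2 = 1.
    by rewrite mulVr // expr1n.
  (* The inverse of [x + y tau theta]: its conjugate divided by its norm [D]. *)
  pose t : Q := Quad (x / D) (- (y * tau / D)).
  pose S := mx2 (qemb d x) (theta * qemb d (y * (tau * tau)))
    (theta * qemb d y) (qemb d x).
  exists (t *: S), t; split; last first.
    rewrite /S !scalemx2; apply/congr_mx2; split; try exact: congr_el_refl.
    apply: (congr_el_comb1 (c1 := t * theta * qemb d y)
             (x1 := qemb d (tau * tau)) (y1 := qemb d a)).
      by apply/congr_quadP; split=> //=; exact: congr_el_refl.
    by rewrite !rmorphM; ring.
  rewrite /GU_G /S scalemx2 ustar_mx2 mulmx2 mx2_1.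
  apply/congr_mx2; split; exists 0; rewrite mulr0;
    apply: quad_eqP; rewrite !(quadE, rmorphM) /= ?quadE /=;
    first [by ring | by apply/eqP; rewrite subr_eq0 -[X in _ == X]DE; apply/eqP; ring].
Qed.

End GU.

Theorem theorem6p10 (O : idomainType) (pi : O) :
  is_cdvr_odd pi ->
  thm6p10_GL pi /\
  (forall d : O, d \is a GRing.unit -> ~ (exists y : O, y * y = d) ->
     thm6p10_GU pi d).
Proof.
move=> hO; split; first exact: thm6p10_GL_holds.
by move=> d ud dns; exact: thm6p10_GU_holds.
Qed.
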